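(* Let $N=[n]$ be a non-empty set of agents and $M=[m]$ a non-empty set of indivisible goods with $m=kn$ for a positive integer $k$. Suppose each agent $i\in N$ has an additive personalized bivalued valuation, i.e., there exist $a_i>b_i\ge 0$ such that $v_{ij}\in\{a_i,b_i\}$ for all $j\in M$. Then there exists a balanced allocation that is both EF1 and fPO. Moreover, such an allocation can be found in polynomial time (given the instance $(N,M,(v_i)_{i\in N})$).
   Context: Each agent $i$ has values $v_{ij}\in\mathbb{R}_{\ge 0}$ for goods $j\in M$ and $v_i(X)=\sum_{j\in X}v_{ij}$ for $X\subseteq M$. An allocation is an ordered partition $A=(A_1,\dots,A_n)$ of $M$ (parts may be empty); it is balanced if $|A_i|=k$ for all $i\in N$. A balanced fractional allocation is a matrix $x\in\mathbb{R}_{\ge 0}^{N\times M}$ with $\sum_{j\in M}x_{ij}=k$ for all $i\in N$ and $\sum_{i\in N}x_{ij}=1$ for all $j\in M$; a balanced allocation $A$ is identified with its $0/1$ matrix ($x_{ij}=1$ iff $j\in A_i$). $A$ is EF1 (envy-free up to one good) if for all $i,i'\in N$ either $A_{i'}=\emptyset$ or there is $j\in A_{i'}$ with $v_i(A_i)\ge v_i(A_{i'}\setminus\{j\})$. A balanced (fractional) allocation $x$ Pareto-dominates a balanced (fractional) allocation $x'$ if $\sum_j v_{ij}x_{ij}\ge\sum_j v_{ij}x'_{ij}$ for all $i\in N$, with strict inequality for some $i$. A balanced allocation is fPO (fractionally Pareto optimal) if no balanced fractional allocation Pareto-dominates it. For the computational claim, valuations are rational numbers encoded in binary and polynomial time is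 with respect to the input encoding length. *)

(* Defs.v *)
From mathcomp Require Import all_boot all_order all_algebra.

Set Implicit Arguments.
Unset Strict Implicit.
Unset Printing Implicit Defensive.

Import Order.TTheory GRing.Theory Num.Theory.

Local Open Scope ring_scope.

Section FairDivision.

Context {R : realFieldType} {n m : nat}.

Implicit Types (v x y : 'M[R]_(n, m)) (A : 'I_n -> {set 'I_m}).

Definition value v (i : 'I_n) (X : {set 'I_m}) : R := \sum_(j in X) v i j.

(* [partition] of finset.v forbids empty parts, and parts are indexed here. *)
Definition allocation A : Prop :=
  (forall i i', i != i' -> [disjoint A i & A i']) /\
  \bigcup_(i < n) A i = [set: 'I_m].

Definition balanced_allocation (k : nat) A : Prop :=
  allocation A /\ forall i, #|A i| = k.

Definition balanced_fractional (k : nat) x : Prop :=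
  [/\ forall i j, 0 <= x i j,
      forall i, \sum_(j < m) x i j = k%:R
    & forall j, \sum_(i < n) x i j = 1].

Definition alloc_mx A : 'M[R]_(n, m) := \matrix_(i, j) (j \in A i)%:R.

Definition EF1 v A : Prop :=
  forall i i', A i' = set0 \/
    exists2 j, j \in A i' & value v i (A i) >= value v i (A i' :\ j).

Definition utility v x (i : 'I_n) : R := \sum_(j < m) v i j * x i j.

Definition pareto_dominates v x y : Prop :=
  (forall i, utility v x i >= utility v y i) /\
  (exists i, utility v x i > utility v y i).

Definition fPO (k : nat) v A : Prop :=
  forall x, balanced_fractional k x -> ~ pareto_dominates v x (alloc_mx A).

Definition personalized_bivalued v : Prop :=
  forall i, exists a b : R,
    [/\ a > b, b >= 0 & forall j, v i j = a \/ v i j = b].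

End FairDivision.

Arguments EF1 {R n m} v A.
Arguments fPO {R n m} k v A.
Arguments alloc_mx R {n m} A.

Local Close Scope ring_scope.

(* Model of computation: while-programs on a random access machine under the
   logarithmic cost criterion.  Memory consists of arrays of natural numbers,
   [s a i] being cell [i] of array [a].  Array names are part of the program
   text, so a program uses finitely many arrays.  Every intermediate value,
   in particular every address, is charged its length in binary; multiplication
   and division are therefore harmless, and polynomial time in this model
   coincides with polynomial time on Turing machines. *)

Definition state := nat -> nat -> nat.

Definition bitlen (a : nat) : nat := (trunc_log 2 a).+1.

Inductive binop := Add | Sub | Mul | Div.

Inductive expr :=
  | Const of nat
  | Read of nat & expr
  | Op of binop & expr & expr.

(* Truncated subtraction; division is Euclidean, with [a %/ 0 = 0]. *)
Definition eval_op (o : binop) : nat -> nat -> nat :=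
  match o with Add => addn | Sub => subn | Mul => muln | Div => divn end.

Fixpoint eval (s : state) (e : expr) : nat :=
  match e with
  | Const c => c
  | Read a e1 => s a (eval s e1)
  | Op o e1 e2 => eval_op o (eval s e1) (eval s e2)
  end.

Fixpoint cost (s : state) (e : expr) : nat :=
  bitlen (eval s e) +
  match e with
  | Const _ => 0
  | Read _ e1 => cost s e1
  | Op _ e1 e2 => cost s e1 + cost s e2
  end.

Inductive program :=
  | Skip
  | Write of nat & expr & expr
  | Seq of program & program
  | If of expr & program & program
  | While of expr & program.

Definition update (s : state) (a i c : nat) : state :=
  fun a' i' => if (a' == a) && (i' == i) then c else s a' i'.

(* [exec p s t s']: started in [s], [p] halts in [s'] after time [t].
   A test succeeds when its value is nonzero. *)
Inductive exec : program -> state -> nat -> state -> Prop :=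
  | ExecSkip s : exec Skip s 1 s
  | ExecWrite a e1 e2 s :
      exec (Write a e1 e2) s (cost s e1 + cost s e2)
        (update s a (eval s e1) (eval s e2))
  | ExecSeq p1 p2 s s1 s2 t1 t2 :
      exec p1 s t1 s1 -> exec p2 s1 t2 s2 ->
      exec (Seq p1 p2) s (t1 + t2) s2
  | ExecIfTrue e p1 p2 s s' t :
      eval s e != 0 -> exec p1 s t s' ->
      exec (If e p1 p2) s (cost s e + t) s'
  | ExecIfFalse e p1 p2 s s' t :
      eval s e = 0 -> exec p2 s t s' ->
      exec (If e p1 p2) s (cost s e + t) s'
  | ExecWhileTrue e p s s1 s2 t1 t2 :
      eval s e != 0 -> exec p s t1 s1 -> exec (While e p) s1 t2 s2 ->
      exec (While e p) s (cost s e + t1 + t2) s2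
  | ExecWhileFalse e p s :
      eval s e = 0 -> exec (While e p) s (cost s e) s.

(* The input is in array 0, the output is expected in array 1. *)
Definition initial_state (w : seq nat) : state :=
  fun a i => if a == 0 then nth 0 w i else 0.

Definition output (s : state) : nat -> nat := s 1.

Definition encoding_length (w : seq nat) : nat := \sum_(c <- w) bitlen c.

(* [n], [m], then numerators and denominators (in lowest terms) of the values
   in row-major order.  The values are nonnegative in every instance
   considered, so the sign of the numerator is not recorded. *)
Definition encode (n m : nat) (v : 'M[rat]_(n, m)) : seq nat :=
  [:: n, m & flatten [seq [:: `|numq (v i j)|%N; `|denq (v i j)|%N]
                     | i <- enum 'I_n, j <- enum 'I_m]].

(* Output format: cell [j] holds the agent receiving good [j]. *)
Definition represents (n m : nat) (f : nat -> nat)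
    (A : 'I_n -> {set 'I_m}) : Prop :=
  forall i j, (j \in A i) = (f j == i).

(* Main.v *)
Require Import Defs.
From mathcomp Require Import all_boot all_order all_algebra.
From mathcomp Require Import zify lra.

(* Up to an affine change of utilities agent [i] just counts the goods she
   values, and a balanced allocation gives her [k] slots.  Let a good she values
   be worth [L - 3 r] in her [r]-th slot, with [L > 3 k m], and any other good
   worth nothing.  An auction in which unassigned goods bid for slots, raising
   prices by one, ends with prices for which every good sits in a slot of maximal
   net worth up to an error of one.  Swapping a valued good of another agent with
   a good she does not value shows that the valued goods of any bundle sit in
   slots no later than her first slot without a valued good: this is EF1.  Since
   [L] exceeds [m] times the total error, the prices divided by [L] can be
   rounded to exact dual variables, so the allocation maximizes the number of
   valued goods among all balanced fractional allocations: this is fPO.  Each bid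
   raises the sum of the prices, which is at most [m (L + 1)], hence the auction
   is polynomial. *)

Set Implicit Arguments.
Unset Strict Implicit.
Unset Printing Implicit Defensive.

Import Order.TTheory GRing.Theory Num.Theory.

(** * Machine model *)

Lemma bitlen_leq a l : 0 < l -> (bitlen a <= l) = (a < 2 ^ l).
Proof.
move=> l_gt0; case: (posnP a) => [-> | a_gt0].
  by rewrite /bitlen trunc_log0 expn_gt0 l_gt0.
have [le_a lt_a] := andP (trunc_log_bounds (isT : 1 < 2) a_gt0).
apply/idP/idP => [le_l | /(leq_ltn_trans le_a)]; last by rewrite ltn_exp2l.
by apply: leq_trans lt_a _; rewrite leq_exp2l.
Qed.

Lemma ltn_bitlen a : a < 2 ^ bitlen a.
Proof. by rewrite -bitlen_leq. Qed.

Lemma leq_bitlen a b : a <= b -> bitlen a <= bitlen b.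
Proof. by move=> leab; rewrite ltnS leq_trunc_log. Qed.

Lemma bitlen_eval_op o a b : bitlen (eval_op o a b) <= bitlen a + bitlen b.
Proof.
have le_add c : c <= a -> bitlen c <= bitlen a + bitlen b.
  by move=> /leq_bitlen h; apply: leq_trans h (leq_addr _ _).
have gt0 : 0 < bitlen a + bitlen b by [].
have a_lt := ltn_bitlen a; have b_lt := ltn_bitlen b.
case: o => /=; last 1 first.
- exact/le_add/leq_div.
- rewrite bitlen_leq // expnD.
  have : 2 <= 2 ^ bitlen a by rewrite -{1}(expn1 2) leq_exp2l.
  have : 2 <= 2 ^ bitlen b by rewrite -{1}(expn1 2) leq_exp2l.
  by nia.
- exact/le_add/leq_subr.
- by rewrite bitlen_leq // expnD ltn_mul.
Qed.

(** Static factors: when all cells have at most [l] bits, [width e * l] bounds the length of the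
    value of [e], and [weight e * l] its cost. *)
Fixpoint width e := match e with
  | Const c => bitlen c
  | Read _ _ => 1
  | Op _ e1 e2 => width e1 + width e2
  end.

Fixpoint weight e := width e + match e with
  | Const _ => 0
  | Read _ e1 => weight e1
  | Op _ e1 e2 => weight e1 + weight e2
  end.

Fixpoint program_weight p := match p with
  | Skip => 1
  | Write _ e1 e2 => weight e1 + weight e2
  | Seq p1 p2 => program_weight p1 + program_weight p2
  | If e p1 p2 => weight e + program_weight p1 + program_weight p2
  | While e p1 => weight e + program_weight p1
  end.

Lemma bitlen_eval s e l : 0 < l -> (forall a i, bitlen (s a i) <= l) ->
  bitlen (eval s e) <= width e * l.
Proof.
move=> l_gt0 s_le; elim: e => [c | a e _ | o e1 IH1 e2 IH2] /=.
- exact: leq_pmulr.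
- by rewrite mul1n.
- by rewrite mulnDl (leq_trans (bitlen_eval_op _ _ _)) ?leq_add.
Qed.

Lemma cost_leq s e l : 0 < l -> (forall a i, bitlen (s a i) <= l) ->
  cost s e <= weight e * l.
Proof.
move=> l_gt0 s_le; elim: e => [c | a e IH | o e1 IH1 e2 IH2] /=.
- by rewrite !addn0 leq_pmulr.
- by rewrite mulnDl leq_add // (bitlen_eval (Read a e)).
- rewrite mulnDl leq_add // ?(bitlen_eval (Op o e1 e2)) //.
  by rewrite mulnDl leq_add.
Qed.

(* [tame c e]: the value of [e] exceeds some memory cell by at most [c]. *)
Fixpoint tame c e := match e with
  | Const d => d <= c
  | Read _ _ => true
  | Op Defs.Sub e1 _ | Op Div e1 _ => tame c e1
  | Op Add e1 (Const d) => (d <= c) && tame (c - d) e1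
  | _ => false
  end.

Fixpoint tame_program p := match p with
  | Skip => true
  | Write _ _ e2 => tame 1 e2
  | Seq p1 p2 | If _ p1 p2 => tame_program p1 && tame_program p2
  | While _ p1 => tame_program p1
  end.

Lemma tame_eval s b c e : (forall a i, s a i <= b) -> tame c e ->
  eval s e <= b + c.
Proof.
move=> s_le; elim: e c => [d | a e _ | o e1 IH1 e2 _] c /=.
- by move/leq_trans; apply; rewrite leq_addl.
- by move=> _; rewrite (leq_trans (s_le _ _)) ?leq_addr.
- case: o => //=; first case: e2 => // d /andP[d_le /IH1] /=; first by lia.
  + by move/IH1/(leq_trans _); apply; rewrite leq_subr.
  + by move/IH1/(leq_trans _); apply; rewrite leq_div.
Qed.

(* [exec] with every test and every instruction charged one unit. *)
Inductive run : program -> state -> nat -> state -> Prop :=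
  | RunSkip s : run Skip s 1 s
  | RunWrite a e1 e2 s :
      run (Write a e1 e2) s 1 (update s a (eval s e1) (eval s e2))
  | RunSeq p1 p2 s s1 s2 t1 t2 :
      run p1 s t1 s1 -> run p2 s1 t2 s2 -> run (Seq p1 p2) s (t1 + t2) s2
  | RunIfTrue e p1 p2 s s' t :
      eval s e != 0 -> run p1 s t s' -> run (If e p1 p2) s t.+1 s'
  | RunIfFalse e p1 p2 s s' t :
      eval s e = 0 -> run p2 s t s' -> run (If e p1 p2) s t.+1 s'
  | RunWhileTrue e p s s1 s2 t1 t2 :
      eval s e != 0 -> run p s t1 s1 -> run (While e p) s1 t2 s2 ->
      run (While e p) s (t1 + t2).+1 s2
  | RunWhileFalse e p s : eval s e = 0 -> run (While e p) s 1 s.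

(* After [t] unit steps a tame program has increased the largest cell by at most
   [t], so that every instruction is executed on numbers of at most
   [bitlen (b + t)] bits. *)
Lemma run_exec p s t s' : run p s t s' -> tame_program p ->
  forall b c, (forall a i, s a i <= b) -> b + t <= c ->
  (forall a i, s' a i <= b + t) /\
  exists2 t', exec p s t' s' & t' <= t * (program_weight p * bitlen c).
Proof.
have costs s0 e b c : (forall a i, s0 a i <= b) -> b <= c ->
    cost s0 e <= weight e * bitlen c.
  move=> s_le b_le; apply: cost_leq => // a i.
  exact/leq_bitlen/(leq_trans (s_le a i)).
elim=> {p s t s'} [s | a e1 e2 s | p1 p2 s s1 s2 t1 t2 _ IH1 _ IH2
  | e p1 p2 s s' t e_s _ IH | e p1 p2 s s' t e_s _ IH
  | e p s s1 s2 t1 t2 e_s _ IH1 _ IH2 | e p s e_s] /= tame_p b c s_le b_le.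
- split=> [a i|]; first by rewrite (leq_trans (s_le _ _)) ?leq_addr.
  by exists 1; [exact: ExecSkip | rewrite !mul1n].
- split=> [a' i|].
    rewrite /update; case: ifP => _; first exact: tame_eval.
    by rewrite (leq_trans (s_le _ _)) ?leq_addr.
  eexists; first exact: ExecWrite.
  by rewrite mul1n mulnDl leq_add // (costs _ _ b) //; lia.
- case/andP: tame_p => tame1 tame2.
  have [s1_le [t1' ex1 t1_le]] := IH1 tame1 b c s_le ltac:(lia).
  have [s2_le [t2' ex2 t2_le]] := IH2 tame2 (b + t1) c s1_le ltac:(lia).
  split=> [a i|]; first by rewrite addnA.
  exists (t1' + t2'); first exact: ExecSeq ex1 ex2.
  by rewrite !mulnDl !mulnDr; lia.
- case/andP: tame_p => tame1 tame2.
  have [s1_le [t1' ex1 t1_le]] := IH tame1 b c s_le ltac:(lia).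
  split=> [a i|]; first by rewrite (leq_trans (s1_le a i)) // addnS.
  exists (cost s e + t1'); first exact: ExecIfTrue.
  have := costs s e b c s_le ltac:(lia).
  by rewrite mulSn !mulnDl !mulnDr; lia.
- case/andP: tame_p => tame1 tame2.
  have [s1_le [t1' ex1 t1_le]] := IH tame2 b c s_le ltac:(lia).
  split=> [a i|]; first by rewrite (leq_trans (s1_le a i)) // addnS.
  exists (cost s e + t1'); first exact: ExecIfFalse.
  have := costs s e b c s_le ltac:(lia).
  by rewrite mulSn !mulnDl !mulnDr; lia.
- have [s1_le [t1' ex1 t1_le]] := IH1 tame_p b c s_le ltac:(lia).
  have [s2_le [t2' ex2 t2_le]] := IH2 tame_p (b + t1) c s1_le ltac:(lia).
  split=> [a i|]; first by rewrite (leq_trans (s2_le a i)) //; lia.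
  exists (cost s e + t1' + t2'); first exact: ExecWhileTrue ex1 ex2.
  have := costs s e b c s_le ltac:(lia).
  by move: t2_le; rewrite /= mulSn !mulnDl !mulnDr; lia.
- split=> [a i|]; first by rewrite (leq_trans (s_le _ _)) ?leq_addr.
  exists (cost s e); first exact: ExecWhileFalse.
  have := costs s e b c s_le ltac:(lia).
  by rewrite mulSn !mulnDl !mulnDr; lia.
Qed.

(** * Total correctness with a budget of unit steps *)

Definition wp p t (Q : state -> Prop) s :=
  exists t' s', [/\ run p s t' s', t' <= t & Q s'].

Lemma wp_conseq p t t' (Q Q' : state -> Prop) s : t <= t' ->
  (forall s', Q s' -> Q' s') -> wp p t Q s -> wp p t' Q' s.
Proof.
move=> le_t QQ' [u [s' [ru le_u Qs']]].
by exists u, s'; split; rewrite ?(leq_trans le_u) //; apply: QQ'.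
Qed.

Lemma wp_skip (Q : state -> Prop) s : Q s -> wp Skip 1 Q s.
Proof. by move=> Qs; exists 1, s; split=> //; exact: RunSkip. Qed.

Lemma wp_write a e1 e2 (Q : state -> Prop) s :
  Q (update s a (eval s e1) (eval s e2)) -> wp (Write a e1 e2) 1 Q s.
Proof. by move=> Qs; exists 1; eexists; split; [exact: RunWrite| |]. Qed.

Lemma wp_seq p1 p2 t1 t2 Q s :
  wp p1 t1 (wp p2 t2 Q) s -> wp (Seq p1 p2) (t1 + t2) Q s.
Proof.
move=> [u1 [s1 [r1 le1 [u2 [s2 [r2 le2 Qs2]]]]]].
by exists (u1 + u2), s2; split; rewrite ?leq_add //; apply: RunSeq r1 r2.
Qed.

Lemma wp_if e p1 p2 t Q s : (eval s e != 0 -> wp p1 t Q s) ->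
  (eval s e = 0 -> wp p2 t Q s) -> wp (If e p1 p2) t.+1 Q s.
Proof.
move=> wp1 wp2; have [e0 | e1] := eqVneq (eval s e) 0.
  move: (wp2 e0) => [u [s' [ru ? ?]]]; exists u.+1, s'; split=> //.
  exact: RunIfFalse.
move: (wp1 e1) => [u [s' [ru ? ?]]]; exists u.+1, s'; split=> //.
  exact: RunIfTrue.
Qed.

Lemma wp_while (I : state -> Prop) (mu : state -> nat) e p t N s :
  (forall s, I s -> eval s e != 0 ->
     wp p t (fun s' => I s' /\ mu s' < mu s) s) ->
  I s -> mu s <= N ->
  wp (While e p) (N * t.+1).+1 (fun s' => I s' /\ eval s' e = 0) s.
Proof.
move=> body; elim: N s => [|N IH] s Is mu_le.
  have [e0 | /(body _ Is)[_ [s' [_ _ [_]]]]] := eqVneq (eval s e) 0.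
    by exists 1, s; split=> //; exact: RunWhileFalse.
  by lia.
have [e0 | e1] := eqVneq (eval s e) 0.
  by exists 1, s; split=> //; exact: RunWhileFalse.
have [t1 [s1 [r1 le1 [Is1 mu1]]]] := body _ Is e1.
have [t2 [s2 [r2 le2 Qs2]]] := IH s1 Is1 ltac:(lia).
exists (t1 + t2).+1, s2; split=> //; last by lia.
exact: RunWhileTrue r1 r2.
Qed.

(** * Equilibria are fair *)

Definition slot_weight c (b : bool) r := b * (c - 3 * r).

(* [g s] is the good in slot [s], i.e. in the [s.2]-th place of agent [s.1], and
   [p s] is the price of that slot; up to an error of one, every good sits in a
   slot of maximal net worth. *)
Definition equilibrium n m k (h : 'I_n -> 'I_m -> bool)
    (g : 'I_n * 'I_k -> 'I_m) (p : 'I_n * 'I_k -> nat) : Prop :=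
  forall s t : 'I_n * 'I_k,
    slot_weight (3 * m * m).+1 (h t.1 (g s)) t.2 + p s <=
    slot_weight (3 * m * m).+1 (h s.1 (g s)) s.2 + p t + 1.

Definition bundle n m k (g : 'I_n * 'I_k -> 'I_m) (i : 'I_n) : {set 'I_m} :=
  [set g (i, r) | r : 'I_k].

(** Each [s] rules out at most [E] of the [L] offsets, so fewer than [L] offsets are ruled out in
    all. *)
Lemma avoid_small_residues (T : finType) (P : T -> nat) E L : #|T| * E < L ->
  exists theta, forall s, E <= (P s + theta) %% L.
Proof.
move=> ltL; have L_gt0 : 0 < L by lia.
pose bad s := [set t : 'I_L | (P s + t) %% L < E].
have bad_le s : #|bad s| <= E.
  pose f (t : 'I_L) : 'I_L := Ordinal (ltn_pmod (P s + t) L_gt0).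
  have f_inj : injective f.
    move=> t t' /(congr1 val)/= /eqP; rewrite eqn_modDl !modn_small //.
    by move/eqP/val_inj.
  rewrite -(card_imset _ f_inj) -[leqRHS](size_iota 0).
  rewrite cardE -(size_map val) uniq_leq_size //.
    by rewrite map_inj_uniq ?enum_uniq //; apply: val_inj.
  move=> x /mapP[y]; rewrite mem_enum => /imsetP[t] + -> ->.
  by rewrite inE mem_iota.
have [t /existsPn nt] : exists t : 'I_L, ~~ [exists s, t \in bad s].
  apply/existsP; apply: contraTT ltL; rewrite negb_exists => /forallP all_bad.
  rewrite -leqNgt -sum_nat_const.
  suff le_L : L <= \sum_s #|bad s|.
    by apply: leq_trans le_L _; apply: leq_sum => s _; apply: bad_le.
  rewrite (eq_bigr (fun s => \sum_(t : 'I_L) (t \in bad s))); last first.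
    by move=> s _; rewrite -sum1_card big_mkcond; apply: eq_bigr => t _; case: ifP.
  rewrite exchange_big /= -[leqLHS]card_ord -sum1_card leq_sum // => t _.
  have /negPn/existsP[s t_s] := all_bad t.
  by rewrite (bigD1 s) //= t_s.
by exists t => s; have := nt s; rewrite inE -leqNgt.
Qed.

Lemma mem_bundle n m k (g : 'I_n * 'I_k -> 'I_m) (i : 'I_n) s :
  injective g -> (g s \in bundle g i) = (s.1 == i).
Proof.
case: s => i' r g_inj; apply/imsetP/eqP => [[r' _ /g_inj[-> _]] // | <-].
by exists r.
Qed.

Lemma card_bundle n m k (g : 'I_n * 'I_k -> 'I_m) (i : 'I_n) :
  injective g -> #|bundle g i| = k.
Proof. by move=> g_inj; rewrite card_imset ?card_ord // => r r' /g_inj[]. Qed.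

Lemma slot_bij n m k (g : 'I_n * 'I_k -> 'I_m) :
  m = k * n -> injective g -> bijective g.
Proof.
by move=> mE g_inj; apply: inj_card_bij; rewrite // card_prod !card_ord mE mulnC.
Qed.

Lemma bundle_balanced n m k (g : 'I_n * 'I_k -> 'I_m) :
  m = k * n -> injective g -> balanced_allocation k (bundle g).
Proof.
move=> mE g_inj; have [f _ fK] := slot_bij mE g_inj.
split; last by move=> i; exact: card_bundle.
split=> [i i' ne_i|].
  apply/pred0P => j /=; rewrite -(fK j) !mem_bundle //.
  by case: eqP => // ->; rewrite (negPf ne_i).
apply/setP => j; rewrite inE -(fK j); apply/bigcupP.
by exists (f j).1; rewrite ?mem_bundle.
Qed.

Section Equilibrium.

Variables (R : realFieldType) (n m k : nat) (v : 'M[R]_(n, m)).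
Variables (h : 'I_n -> 'I_m -> bool) (b d : 'I_n -> R).
Variables (g : 'I_n * 'I_k -> 'I_m) (p : 'I_n * 'I_k -> nat).

Hypothesis vE : forall i j, v i j = (b i + d i * (h i j)%:R)%R.
Hypothesis b_ge0 : forall i, (0 <= b i)%R.
Hypothesis d_gt0 : forall i, (0 < d i)%R.
Hypothesis k_gt0 : 0 < k.
Hypothesis mE : m = k * n.
Hypothesis g_inj : injective g.
Hypothesis eq_p : equilibrium h g p.

Let n_gt0 (i : 'I_n) : 0 < n. Proof. exact: leq_ltn_trans (ltn_ord i). Qed.

Let k_le_m (i : 'I_n) : k <= m.
Proof. by rewrite mE leq_pmulr ?(n_gt0 i). Qed.

Lemma value_bundle i (X : {set 'I_m}) :
  (value v i X = b i *+ #|X| + d i * #|[set j in X | h i j]|%:R)%R.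
Proof.
rewrite /value (eq_bigr (fun j => b i + d i * (h i j)%:R)%R) => [|j _]; last first.
  exact: vE.
rewrite big_split /= sumr_const -mulr_sumr; congr (_ + _ * _)%R.
rewrite -sum1_card natr_sum big_mkcond [RHS]big_mkcond /=.
by apply: eq_bigr => j _; rewrite inE; case: (j \in X); case: (h i j).
Qed.

(* Exchanging the goods of the two slots would gain if [t.2 < s.2]. *)
Lemma swap_rank i s t : t.1 = i -> ~~ h i (g t) -> h i (g s) -> s.2 <= t.2.
Proof.
(* Adding the two conditions cancels the prices and leaves an error of two, less than the drop of
   three between consecutive slots. The weight exceeds [3 * k], so no subtraction truncates. *)
move=> ti ht hs; have e1 := eq_p s t; have e2 := eq_p t s.
move: e1 e2; rewrite ti hs (negPf ht) /slot_weight mul0n mul1n.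
have := k_le_m i; have := ltn_ord t.2; have := ltn_ord s.2.
have : 3 * m <= 3 * m * m by have := k_le_m i; nia.
by case: (h s.1 (g s)); case: (h s.1 (g t)) => /=; lia.
Qed.

(** Let [r] be the first slot of agent [i] with a good she does not value: the slots before it give
    her [r] valued goods, while by [swap_rank] those in the other bundle lie in slots [0] to [r].
    Without such a slot her whole bundle is valued, and all bundles have the same size. *)
Lemma card_valued i i' :
  #|[set j in bundle g i' | h i j]| <= (#|[set j in bundle g i | h i j]|).+1.
Proof.
have [all_h | [r0 r0P]] : (forall r, h i (g (i, r))) \/ exists r, ~~ h i (g (i, r)).
  case: (boolP [forall r, h i (g (i, r))]) => [/forallP | /forallPn]; by auto.
  rewrite leqW // (@leq_trans k) //.
    rewrite -[leqRHS](card_bundle i' g_inj) subset_leq_card //.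
    by apply/subsetP => j; rewrite inE => /andP[].
  rewrite -[leqLHS](card_bundle i g_inj) subset_leq_card //.
  by apply/subsetP => j /imsetP[r _ ->]; rewrite inE all_h mem_bundle //= eqxx.
have [r hr r_min] := @arg_minnP _ r0 (fun r => ~~ h i (g (i, r))) val r0P.
have le_r : r <= #|[set j in bundle g i | h i j]|.
  pose f (r' : 'I_r) := g (i, widen_ord (ltnW (ltn_ord r)) r').
  have f_inj : injective f by move=> x y /g_inj[] /val_inj.
  rewrite -[leqLHS]card_ord -(card_imset _ f_inj) subset_leq_card //.
  apply/subsetP => j /imsetP[r' _ ->]; rewrite inE mem_bundle //= eqxx /=.
  apply: contraTT (ltn_ord r') => nh; rewrite -leqNgt.
  exact: (r_min (widen_ord _ _) nh).
apply: leq_trans (_ : r.+1 <= _) => //.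
pose f (r' : 'I_r.+1) := g (i', widen_ord (ltn_ord r) r').
rewrite -[leqRHS]card_ord -cardsT; apply: leq_trans (leq_imset_card f _).
apply/subset_leq_card/subsetP => j; rewrite inE => /andP[/imsetP[r' _ ->] hj].
have lt_r' : r' < r.+1 by exact: (swap_rank (i := i) (s := (i', r')) (t := (i, r))).
by apply/imsetP; exists (Ordinal lt_r') => //; congr (g (_, _)); apply: val_inj.
Qed.

(** All bundles have size [k], so only the counts of valued goods matter. By [card_valued] removing
    one valued good suffices; if there is none, any good will do. *)
Lemma equilibrium_EF1 : EF1 v (bundle g).
Proof.
move=> i i'; right; have le_h := card_valued i i'.
have cX := card_bundle i g_inj; have cX' := card_bundle i' g_inj.
have valD j : j \in bundle g i' ->
    (value v i (bundle g i' :\ j) = value v i (bundle g i') - v i j)%R.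
  by move=> jX; rewrite /value [X in (X - _)%R](big_setD1 j) //= addrAC subrr add0r.
have [no_h | [j]] := set_0Vmem [set j in bundle g i' | h i j].
  exists (g (i', Ordinal k_gt0)); first by rewrite mem_bundle //=.
  rewrite valD ?mem_bundle //= !value_bundle cX cX' no_h cards0 mulr0 addr0 vE.
  have : (0 <= d i * #|[set j in bundle g i | h i j]|%:R :> R)%R.
    by rewrite mulr_ge0 // ltW.
  have : (0 <= d i * (h i (g (i', Ordinal k_gt0)))%:R :> R)%R.
    by rewrite mulr_ge0 // ltW.
  by have := b_ge0 i; lra.
rewrite inE => /andP[jX hj]; exists j => //.
rewrite valD // !value_bundle cX cX' vE hj.
have : (d i * #|[set j in bundle g i' | h i j]|%:R <=
        d i * #|[set j in bundle g i | h i j]|.+1%:R :> R)%R.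
  by rewrite ler_wpM2l ?ler_nat // ltW.
rewrite mulr1n mulrSr mulrDr mulr1; set hX := (d i * _)%R; set hX' := (d i * _)%R.
by have := b_ge0 i; lra.
Qed.

(* The prices only certify optimality up to a bounded error; rounding them to
   multiples of the large weight, at an offset where no rounding is tight,
   gives exact dual variables for the problem of maximizing the number of goods
   assigned to agents who value them. *)
Lemma exact_duals : exists q : 'I_n * 'I_k -> nat,
  forall s t, h t.1 (g s) + q s <= h s.1 (g s) + q t.
Proof.
set L := (3 * m * m).+1.
(* There are [m] slots, and [m * (3 * k) <= 3 * m * m < L]. *)
have [theta theta_ok] : exists theta, forall s, 3 * k <= (p s + theta) %% L.
  apply: avoid_small_residues; rewrite card_prod !card_ord /L.
  rewrite (mulnC n) -mE ltnS; case: (posnP n) => [n0 | np].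
    by rewrite mE n0 muln0.
  by have : k <= m by [rewrite mE leq_pmulr]; nia.
(* The residue of [p s + theta], at least [3 * k], covers the decrement [3 * t.2] and the error of
   one, while the other residue is below [L]; hence the quotients satisfy the inequality without
   error. *)
exists (fun s => (p s + theta) %/ L) => s t.
have := eq_p s t; rewrite -/L /slot_weight.
have := theta_ok s; have := divn_eq (p s + theta) L.
have : (p t + theta) %% L < L by exact: ltn_pmod.
have := divn_eq (p t + theta) L.
set qs := _ %/ L; set qt := _ %/ L; set rs := _ %% L; set rt := _ %% L.
have := ltn_ord t.2.
have : 3 * m <= L by rewrite /L; have := k_le_m t.1; nia.
have := k_le_m t.1.
case: (h t.1 (g s)); case: (h s.1 (g s)) => /=; nia.
Qed.

Lemma sum_slots (F : 'I_n * 'I_k -> R) :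
  (\sum_s F s = \sum_i \sum_r F (i, r))%R.
Proof. by rewrite pair_bigA; apply: eq_bigr => -[]. Qed.

Lemma sum_goods (F : 'I_m -> R) : (\sum_j F j = \sum_s F (g s))%R.
Proof. exact/reindex/onW_bij/slot_bij. Qed.

(** Weak linear programming duality. The entries [x t.1 (g s)], indexed by pairs of slots, have all
    row and column sums equal to [k]. Summing the inequalities of [exact_duals] with these weights
    cancels [q] and leaves both sides scaled by [k]. *)
Lemma valued_leq x : balanced_fractional k x ->
  (\sum_i \sum_j (h i j)%:R * x i j <=
   \sum_i \sum_j (h i j)%:R * alloc_mx R (bundle g) i j :> R)%R.
Proof.
move=> [x_ge0 x_row x_col]; have [q qP] := exact_duals.
have kR : (0 < k%:R :> R)%R by rewrite ltr0n.
have alloc_sum : (\sum_i \sum_j (h i j)%:R * alloc_mx R (bundle g) i j =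
                 \sum_s (h s.1 (g s))%:R :> R)%R.
  rewrite exchange_big sum_goods; apply: eq_bigr => s _.
  rewrite (bigD1 s.1) //= !mxE mem_bundle // eqxx mulr1 big1 ?addr0 // => i ne.
  by rewrite mxE mem_bundle // eq_sym (negPf ne) mulr0.
rewrite alloc_sum -(ler_pM2l kR).
have sumP :
  (\sum_(s : 'I_n * 'I_k) \sum_(t : 'I_n * 'I_k)
     ((h t.1 (g s))%:R + (q s)%:R) * x t.1 (g s) <=
   \sum_(s : 'I_n * 'I_k) \sum_(t : 'I_n * 'I_k)
     ((h s.1 (g s))%:R + (q t)%:R) * x t.1 (g s))%R.
  apply: ler_sum => s _; apply: ler_sum => t _.
  by rewrite ler_wpM2r // -!natrD ler_nat.
have col s : (\sum_(t : 'I_n * 'I_k) x t.1 (g s) = k%:R)%R.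
  rewrite sum_slots (eq_bigr (fun i => x i (g s) * k%:R)%R); last first.
    by move=> i _; rewrite /= sumr_const card_ord mulr_natr.
  by rewrite -mulr_suml x_col mul1r.
have row (t : 'I_n * 'I_k) : (\sum_s x t.1 (g s) = k%:R)%R.
  by rewrite -(sum_goods (x t.1)) x_row.
have hx :
  (\sum_(s : 'I_n * 'I_k) \sum_(t : 'I_n * 'I_k) (h t.1 (g s))%:R * x t.1 (g s) =
    k%:R * \sum_i \sum_j (h i j)%:R * x i j)%R.
  rewrite exchange_big sum_slots mulr_sumr; apply: eq_bigr => i _.
  rewrite (eq_bigr (fun=> \sum_j (h i j)%:R * x i j))%R => [|r _].
    by rewrite /= sumr_const card_ord mulr_natl.
  by rewrite sum_goods.
have qx : (\sum_(s : 'I_n * 'I_k) \sum_(t : 'I_n * 'I_k) (q s)%:R * x t.1 (g s) =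
           \sum_(s : 'I_n * 'I_k) \sum_(t : 'I_n * 'I_k) (q t)%:R * x t.1 (g s))%R.
  rewrite [RHS]exchange_big; apply: eq_bigr => s _ /=.
  by rewrite -!mulr_sumr col row.
have hs :
  (\sum_(s : 'I_n * 'I_k) \sum_(t : 'I_n * 'I_k) (h s.1 (g s))%:R * x t.1 (g s) =
    k%:R * \sum_s (h s.1 (g s))%:R)%R.
  by rewrite mulr_sumr; apply: eq_bigr => s _; rewrite -mulr_sumr col mulrC.
have split_sum (F G : 'I_n * 'I_k -> 'I_n * 'I_k -> R) :
  (\sum_(s : 'I_n * 'I_k) \sum_(t : 'I_n * 'I_k) (F s t + G s t) * x t.1 (g s) =
   \sum_(s : 'I_n * 'I_k) \sum_(t : 'I_n * 'I_k) F s t * x t.1 (g s) +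
   \sum_(s : 'I_n * 'I_k) \sum_(t : 'I_n * 'I_k) G s t * x t.1 (g s))%R.
  rewrite -big_split; apply: eq_bigr => s _; rewrite -big_split.
  by apply: eq_bigr => t _; rewrite mulrDl.
by move: sumP; rewrite !split_sum hx hs qx lerD2r.
Qed.

Lemma utilityE x i : balanced_fractional k x ->
  (utility v x i = b i * k%:R + d i * \sum_j (h i j)%:R * x i j)%R.
Proof.
case=> _ x_row _; rewrite -(x_row i) !mulr_sumr -big_split.
by apply: eq_bigr => j _; rewrite vE mulrDl mulrA.
Qed.

Lemma alloc_mx_fractional : balanced_fractional k (alloc_mx R (bundle g)).
Proof.
have [f _ fK] := slot_bij mE g_inj.
split=> [i j | i | j]; first by rewrite mxE.
  rewrite -[in RHS](card_bundle i g_inj) -sum1_card natr_sum [RHS]big_mkcond /=.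
  by apply: eq_bigr => j _; rewrite mxE; case: (_ \in _).
rewrite (bigD1 (f j).1) //= mxE -{1}(fK j) mem_bundle // eqxx big1 ?addr0 // => i ne.
by rewrite mxE -(fK j) mem_bundle // eq_sym (negPf ne).
Qed.

(** By balance, base values contribute constants to the utilities, so a Pareto improvement would
    strictly increase the total mass of valued goods, against [valued_leq]. *)
Lemma equilibrium_fPO : fPO k v (bundle g).
Proof.
have alloc_frac := alloc_mx_fractional.
move=> x x_frac [ge_x [i0 gt_x]]; have := valued_leq x_frac.
have leP i : (\sum_j (h i j)%:R * alloc_mx R (bundle g) i j <=
    \sum_j (h i j)%:R * x i j :> R)%R.
  by have := ge_x i; rewrite !utilityE // lerD2l ler_pM2l.
apply/negP; rewrite -ltNge (bigD1 i0) //= [ltRHS](bigD1 i0) //=.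
apply: ltr_leD; last by apply: ler_sum => i _.
by move: gt_x; rewrite !utilityE // ltrD2l ltr_pM2l.
Qed.

End Equilibrium.

(** * The auction *)

Section Auction.

Variables (m L : nat) (w : nat -> nat -> nat).
Hypothesis w_le : forall j t, w j t <= L.

(* [o s] is one plus the good in slot [s], or [0] if the slot is free; [cur] is
   one plus the good that bids next, and exactly [cnt] slots are occupied, by
   goods among the first [cnt + 1]. *)
Record auction_inv (p o : nat -> nat) (cur cnt : nat) : Prop := AuctionInv {
  free_price : forall s, s < m -> o s = 0 -> p s = 0;
  almost_best : forall s t, s < m -> t < m -> o s != 0 ->
    w (o s).-1 t + p s <= w (o s).-1 s + p t + 1;
  price_le : forall s, s < m -> p s <= L.+1;
  owner_inj : forall s t, s < m -> t < m -> o s != 0 -> o s = o t -> s = t;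
  owner_cur : forall s, s < m -> o s != cur;
  owner_le : forall s, s < m -> o s <= cnt.+1;
  cur_bounds : 0 < cur <= cnt.+1;
  cnt_le : cnt <= m;
  cur_last : cnt = m -> cur = m.+1;
  cnt_owner : \sum_(s < m) (o s != 0) = cnt }.

Lemma auction_init (p o : nat -> nat) :
  0 < m -> p =1 (fun=> 0) -> o =1 (fun=> 0) -> auction_inv p o 1 0.
Proof.
move=> m_gt0 p0 o0; split=> //.
- by move=> s t _ _; rewrite o0.
- by move=> s _; rewrite p0.
- by move=> s t _ _; rewrite o0.
- by move=> s _; rewrite o0.
- by move=> s _; rewrite o0.
- by move=> m0; rewrite -m0 in m_gt0.
- by apply: big1 => s _; rewrite o0.
Qed.

Section Step.

Variables (p o p' o' : nat -> nat) (cur cnt b : nat).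
Hypothesis inv : auction_inv p o cur cnt.
Hypothesis cnt_lt : cnt < m.
Hypothesis b_lt : b < m.
Hypothesis b_best : forall t, t < m -> w cur.-1 t + p b <= w cur.-1 b + p t.
Hypothesis pE : p' =1 (fun t => if t == b then p t + 1 else p t).
Hypothesis oE : o' =1 (fun t => if t == b then cur else o t).

Lemma free_slot : exists2 s, s < m & o s = 0.
Proof.
have [/existsP[s /eqP os] | /existsPn all_o] := boolP [exists s : 'I_m, o s == 0].
  by exists s.
have := cnt_owner inv; rewrite (eq_bigr (fun=> 1)) => [|s _].
  by rewrite sum_nat_const card_ord muln1 => mE; have := cnt_lt; rewrite -mE ltnn.
by rewrite all_o.
Qed.

(* A free slot has price zero, so a bid never exceeds the largest weight. *)
Lemma bid_le : p b <= L.
Proof.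
have [s s_lt os] := free_slot.
have := b_best s_lt; rewrite (free_price inv s_lt os).
by have := w_le cur.-1 b; lia.
Qed.

(** The bid raises the price of a best slot by one, exactly the tolerance of [almost_best]; to the
    other goods slot [b] only becomes less attractive. The next bidder is the evicted good or, if
    the slot was free, the next fresh good, which after the last one is the sentinel [m.+1]. *)
Lemma auction_step :
  auction_inv p' o' (if o b == 0 then cnt.+2 else o b) (cnt + (o b == 0)).
Proof.
have [free best plev oinj ocur ole /andP[cur_gt0 cur_le] cntm last sumo] := inv.
split.
- move=> s s_lt; rewrite oE pE; case: eqP => [_ c0 | _]; last exact: free.
  by rewrite c0 in cur_gt0.
- move=> s t s_lt t_lt; rewrite oE !pE; case: (eqVneq s b) => [-> _ | _ os].
    by have := b_best t_lt; case: ifP => _; lia.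
  by have := best s t s_lt t_lt os; case: ifP => _; lia.
- move=> s s_lt; rewrite pE; case: eqP => [-> | _]; last exact: plev.
  by have := bid_le; lia.
- move=> s t s_lt t_lt; rewrite !oE.
  case: (eqVneq s b) => [-> | _]; case: (eqVneq t b) => [-> | _] //.
  + by move=> _ /esym/eqP; rewrite (negPf (ocur _ t_lt)).
  + by move=> _ /eqP; rewrite (negPf (ocur _ s_lt)).
  + exact: oinj.
- move=> s s_lt; rewrite oE; have := ole s s_lt; have := ocur b b_lt.
  case: (eqVneq s b) => [-> | ne_sb]; case: (eqVneq (o b) 0) => [ob | ob] /=;
    try by lia.
  by move=> _ _; apply: contra ne_sb => /eqP e; apply/eqP/esym/oinj.
- move=> s s_lt; rewrite oE; have := ole s s_lt.
  by case: (eqVneq s b) => _; case: (o b == 0) => /=; lia.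
- by have := ole b b_lt; case: (eqVneq (o b) 0) => ob /=; lia.
- by case: (o b == 0) => /=; lia.
- by case: (o b == 0) => /=; lia.
- rewrite -sumo (bigD1 (Ordinal b_lt)) //= [in RHS](bigD1 (Ordinal b_lt)) //=.
  rewrite oE eqxx (eq_bigr (fun s : 'I_m => nat_of_bool (o s != 0))); last first.
    move=> s ne; rewrite oE; case: (val s =P b) ne => // e /negP[].
    exact/eqP/val_inj.
  by case: cur cur_gt0 => // c _; case: (o b == 0) => /=; lia.
Qed.

Lemma auction_progress :
  m * L.+1 - \sum_(s < m) p' s < m * L.+1 - \sum_(s < m) p s.
Proof.
have inv' := auction_step.
have sum_le : \sum_(s < m) p' s <= m * L.+1.
  rewrite -[X in X * _]card_ord -sum_nat_const.
  by apply: leq_sum => s _; apply: (price_le inv').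
suff : \sum_(s < m) p' s = (\sum_(s < m) p s).+1 by lia.
rewrite (bigD1 (Ordinal b_lt)) //= [in RHS](bigD1 (Ordinal b_lt)) //= pE eqxx.
rewrite addn1 addSn; congr (_ + _).+1; apply: eq_bigr => s ne.
by rewrite pE; case: (val s =P b) ne => // e /negP[]; apply/eqP/val_inj.
Qed.

End Step.

(** With [m] occupied slots none is free, and the bidder is the sentinel [m.+1], which owns no
    slot. *)
Lemma auction_final p o cur s : auction_inv p o cur m -> s < m -> 0 < o s <= m.
Proof.
move=> inv s_lt; have := owner_le inv s_lt; have := owner_cur inv s_lt.
rewrite (cur_last inv erefl) => ne le_o; apply/andP; split; last by lia.
have := cnt_owner inv; rewrite (bigD1 (Ordinal s_lt)) //= lt0n.
case: (o s != 0) => //; rewrite add0n => sumE.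
have : \sum_(i < m | i != Ordinal s_lt) (o i != 0) <=
       \sum_(i < m | i != Ordinal s_lt) 1 by apply: leq_sum => i _; case: (_ != _).
by rewrite sumE sum1_card cardC1 card_ord; lia.
Qed.

End Auction.

(** * The allocation program *)

Definition scalar a := Read a (Const 0).
Definition agents := Read 0 (Const 0).
Definition goods := Read 0 (Const 1).
Definition succ e := Op Add e (Const 1).
Definition modulo e1 e2 := Op Defs.Sub e1 (Op Mul (Op Div e1 e2) e2).
Definition numerator e := Read 0 (Op Add (Op Mul (Const 2) e) (Const 2)).
Definition denominator e := Read 0 (Op Add (Op Mul (Const 2) e) (Const 3)).

(* Array 2 marks the pairs in which the agent values the good above the minimum
   of the agent's row; a triple (agent, good, other good) is coded as
   [x = (agent * m + good) * m + other good]. *)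
Definition mark_valued : program :=
  let x := scalar 5 in
  let y := Op Div x goods in
  let y' := Op Add (Op Mul (Op Div y goods) goods) (modulo x goods) in
  While (Op Defs.Sub (Op Mul (Op Mul agents goods) goods) x)
    (Seq (If (Op Defs.Sub (Op Mul (numerator y) (denominator y'))
                          (Op Mul (numerator y') (denominator y)))
            (Write 2 y (Const 1)) Skip)
         (Write 5 (Const 0) (succ x))).

(** Slots are numbered by rank first: number [t] is the place [t %/ n] of agent [t %% n]. *)
Definition slot_weight_expr j t :=
  Op Mul (Read 2 (Op Add (Op Mul (modulo t agents) goods) j))
    (Op Defs.Sub (succ (Op Mul (Op Mul (Const 3) goods) goods))
                 (Op Mul (Const 3) (Op Div t agents))).

(** Net worths are compared with the prices moved to the opposite sides, since subtraction
    truncates. *)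
Definition find_best : program :=
  let x := scalar 5 in
  let best := scalar 8 in
  let j := Op Defs.Sub (scalar 6) (Const 1) in
  While (Op Defs.Sub goods x)
    (Seq (If (Op Defs.Sub (Op Add (slot_weight_expr j x) (Read 3 best))
                          (Op Add (slot_weight_expr j best) (Read 3 x)))
            (Write 8 (Const 0) x) Skip)
         (Write 5 (Const 0) (succ x))).

(* Arrays 3 and 4 hold the prices and the owners of the slots; the scalars in
   arrays 6 and 7 are the bidding good and the number of occupied slots. *)
Definition auction : program :=
  While (Op Defs.Sub goods (scalar 7))
    (Seq (Write 5 (Const 0) (Const 0))
    (Seq (Write 8 (Const 0) (Const 0))
    (Seq find_best
    (Seq (Write 9 (Const 0) (Read 4 (scalar 8)))
    (Seq (Write 3 (scalar 8) (succ (Read 3 (scalar 8))))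
    (Seq (Write 4 (scalar 8) (scalar 6))
         (If (scalar 9)
            (Write 6 (Const 0) (scalar 9))
            (Seq (Write 7 (Const 0) (succ (scalar 7)))
                 (Write 6 (Const 0) (succ (scalar 7))))))))))).

Definition write_output : program :=
  Seq (Write 5 (Const 0) (Const 0))
    (While (Op Defs.Sub goods (scalar 5))
       (Seq (Write 1 (Op Defs.Sub (Read 4 (scalar 5)) (Const 1))
                     (modulo (scalar 5) agents))
            (Write 5 (Const 0) (succ (scalar 5))))).

Definition allocate : program :=
  Seq mark_valued (Seq (Write 6 (Const 0) (Const 1)) (Seq auction write_output)).

(** The values written are copies, small constants, remainders or increments by one; products occur
    only in tests, addresses and subtrahends. *)
Lemma tame_allocate : tame_program allocate.
Proof. by []. Qed.

(** * Correctness of the program *)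

Section Correctness.

Variables (n m : nat) (inp : nat -> nat).
Hypothesis n_gt0 : 0 < n.
Hypothesis m_gt0 : 0 < m.
Hypothesis inp0 : inp 0 = n.
Hypothesis inp1 : inp 1 = m.

Lemma sub_divn a b : a - a %/ b * b = a %% b.
Proof. by rewrite {1}(divn_eq a b) addKn. Qed.

(** For a triple [x], [y] and [y'] index the entries of the two goods in the agent's row;
    cross-multiplication tests whether the entry at [y] is the larger one. *)
Definition exceeds x :=
  let y := x %/ m in
  let y' := y %/ m * m + x %% m in
  inp (2 * y' + 2) * inp (2 * y + 3) < inp (2 * y + 2) * inp (2 * y' + 3).

Definition valued x y : bool :=
  has (fun z => (z %/ m == y) && exceeds z) (iota 0 x).

Lemma valuedS x y : valued x.+1 y = valued x y || (x %/ m == y) && exceeds x.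
Proof. by rewrite /valued -addn1 iotaD has_cat /= orbF. Qed.

Lemma subn_eq0_ltn a b : (a - b != 0) = (b < a).
Proof. by rewrite subn_eq0 -ltnNge. Qed.

Lemma wp_mark_valued s : s 0 =1 inp -> (forall a i, a != 0 -> s a i = 0) ->
  wp mark_valued (n * m * m * 4).+1
    (fun s' => [/\ forall a i, a != 2 -> a != 5 -> s' a i = s a i
                 & forall y, s' 2 y = valued (n * m * m) y]) s.
Proof.
move=> s_inp s_0.
pose I (s' : state) := [/\ forall a i : nat, a != 2 -> a != 5 -> s' a i = s a i,
  s' 5 0 <= n * m * m & forall y, s' 2 y = valued (s' 5 0) y].
pose mu (s' : state) := n * m * m - s' 5 0.
have I0 : I s by split=> // [|y]; rewrite !s_0.
have mu0 : mu s <= n * m * m by exact: leq_subr.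
have I_inp s1 : I s1 -> s1 0 =1 inp by case=> frame _ _ i; rewrite frame.
apply: (wp_conseq (leqnn _) _ (wp_while (I := I) (t := 3) _ I0 mu0)).
  move=> s1 [Is1 /= /eqP]; rewrite !I_inp // inp0 inp1 subn_eq0.
  have [frame x_le tab] := Is1; move=> le_x; split=> // y; rewrite tab.
  by congr (nat_of_bool (valued _ y)); apply/eqP; rewrite eqn_leq x_le.
move=> s1 Is1 /=; rewrite !I_inp // inp0 inp1 subn_eq0_ltn => x_lt.
have [frame x_le tab] := Is1.
apply: (@wp_seq _ _ 2 1); apply: wp_if.
  rewrite /= !I_inp // inp1 sub_divn subn_eq0_ltn => cond.
  apply/wp_write/wp_write; rewrite /= !I_inp // inp1 /mu /update /=.
  split; last by lia.
  split=> /= [a i ne2 ne5 | | y]; [ | lia |].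
    by rewrite (negPf ne2) (negPf ne5); exact: frame.
  rewrite addn1 valuedS tab /exceeds cond andbT eq_sym.
  by case: eqP => _; rewrite ?orbT ?orbF.
rewrite /= !I_inp // inp1 sub_divn => /eqP; rewrite subn_eq0 leqNgt => /negPf cond.
apply/wp_skip/wp_write; rewrite /= /mu /update /=; split; last by lia.
split=> /= [a i ne2 ne5 | | y]; [by rewrite (negPf ne5); exact: frame | lia |].
by rewrite addn1 valuedS tab /exceeds cond andbF orbF.
Qed.

Section BiddingLoop.

Variable tab : nat -> bool.

Definition worth j t :=
  slot_weight (3 * m * m).+1 (tab (t %% n * m + j)) (t %/ n).

Lemma eval_worth s j t : s 0 =1 inp -> (forall y, s 2 y = tab y) ->
  eval s (slot_weight_expr j t) = worth (eval s j) (eval s t).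
Proof.
by move=> s_inp s_tab; rewrite /= !s_inp inp0 inp1 sub_divn s_tab addn1.
Qed.

Lemma wp_find_best s : s 0 =1 inp -> (forall y, s 2 y = tab y) ->
  s 5 0 = 0 -> s 8 0 = 0 ->
  wp find_best (m * 4).+1
    (fun s' => [/\ forall a i, a != 5 -> a != 8 -> s' a i = s a i, s' 8 0 < m
      & forall t, t < m -> worth (s 6 0).-1 t + s 3 (s' 8 0) <=
                           worth (s 6 0).-1 (s' 8 0) + s 3 t]) s.
Proof.
move=> s_inp s_tab s5 s8.
pose I (s' : state) := [/\ forall a i : nat, a != 5 -> a != 8 -> s' a i = s a i,
  s' 5 0 <= m, s' 8 0 < m & forall t, t < s' 5 0 ->
    worth (s 6 0).-1 t + s 3 (s' 8 0) <= worth (s 6 0).-1 (s' 8 0) + s 3 t].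
pose mu (s' : state) := m - s' 5 0.
have I0 : I s by split; rewrite ?s5 ?s8.
have mu0 : mu s <= m by exact: leq_subr.
have I_inp s1 : I s1 -> s1 0 =1 inp by case=> frame _ _ _ i; rewrite frame.
have I_tab s1 : I s1 -> forall y, s1 2 y = tab y.
  by case=> frame _ _ _ i; rewrite frame.
apply: (wp_conseq (leqnn _) _ (wp_while (I := I) (t := 3) _ I0 mu0)).
  move=> s1 [Is1 /= /eqP]; rewrite !I_inp // inp1 subn_eq0.
  have [frame x_le best_lt best] := Is1; move=> le_x; split=> // t t_lt.
  exact/best/(leq_trans t_lt).
move=> s1 Is1; rewrite [eval _ _]/= !I_inp // inp1 subn_eq0_ltn => x_lt.
have [frame x_le best_lt best] := Is1.
have condE : eval s1 (Op Defs.Sub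
    (Op Add (slot_weight_expr (Op Defs.Sub (scalar 6) (Const 1)) (scalar 5))
            (Read 3 (scalar 8)))
    (Op Add (slot_weight_expr (Op Defs.Sub (scalar 6) (Const 1)) (scalar 8))
            (Read 3 (scalar 5)))) =
  worth (s 6 0).-1 (s1 5 0) + s 3 (s1 8 0) -
  (worth (s 6 0).-1 (s1 8 0) + s 3 (s1 5 0)).
  (* Only the outermost operations are unfolded, so that [eval_worth] still recognizes the weight
     expressions. *)
  have -> o e1 e2 : eval s1 (Op o e1 e2) = eval_op o (eval s1 e1) (eval s1 e2) by [].
  have -> e1 e2 : eval s1 (Op Add e1 e2) = eval s1 e1 + eval s1 e2 by [].
  have -> e1 e2 : eval s1 (Op Add e1 e2) = eval s1 e1 + eval s1 e2 by [].
  rewrite !eval_worth; try by [exact: I_inp | exact: I_tab].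
  by rewrite /= !(frame 3) ?(frame 6) ?subn1.
apply: (@wp_seq _ _ 2 1); apply: wp_if; rewrite condE ?subn_eq0_ltn => cond.
  apply/wp_write/wp_write; rewrite /= /mu /update /=; split; last by lia.
  split=> //= [a i ne5 ne8 | | t]; [ | lia |].
    by rewrite (negPf ne5) (negPf ne8); exact: frame.
  rewrite addn1 ltnS leq_eqVlt => /orP[/eqP-> // | /best]; lia.
apply/wp_skip/wp_write; rewrite /= /mu /update /=; split; last by lia.
split=> //= [a i ne5 ne8 | | t]; [by rewrite (negPf ne5); exact: frame | lia |].
by rewrite addn1 ltnS leq_eqVlt => /orP[/eqP-> | /best]; lia.
Qed.

Lemma worth_le j t : worth j t <= (3 * m * m).+1.
Proof. by rewrite /worth /slot_weight; case: (tab _); rewrite ?mul1n ?leq_subr. Qed.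

Lemma wp_auction s : s 0 =1 inp -> (forall y, s 2 y = tab y) ->
  s 3 =1 (fun=> 0) -> s 4 =1 (fun=> 0) -> s 6 0 = 1 -> s 7 0 = 0 ->
  wp auction (m * (3 * m * m).+2 * (4 * m + 10)).+1
    (fun s' => s' 0 =1 inp /\
       exists cur, auction_inv m (3 * m * m).+1 worth (s' 3) (s' 4) cur m) s.
Proof.
set L := (3 * m * m).+1 => s_inp s_tab s3 s4 s6 s7.
pose I (s' : state) := [/\ s' 0 =1 inp, forall y, s' 2 y = tab y &
  auction_inv m L worth (s' 3) (s' 4) (s' 6 0) (s' 7 0)].
pose mu (s' : state) := m * L.+1 - \sum_(i < m) s' 3 i.
have I0 : I s by split=> //; rewrite s6 s7; exact: auction_init.
have mu0 : mu s <= m * L.+1 by exact: leq_subr.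
(* An iteration takes at most [4 * m + 9] steps besides its test. *)
rewrite addnS.
apply: (wp_conseq (leqnn _) _ (wp_while (I := I) _ I0 mu0)).
  move=> s1 [[s1_inp _ inv] /= /eqP]; rewrite !s1_inp inp1 subn_eq0 => m_le.
  split=> //; exists (s1 6 0); rewrite {2}(_ : m = s1 7 0) //.
  by apply/eqP; rewrite eqn_leq m_le (cnt_le inv).
move=> s1 [s1_inp s1_tab inv]; rewrite [eval _ _]/= !s1_inp inp1 subn_eq0_ltn.
move=> cnt_lt.
apply: (wp_conseq (t := 1 + (1 + ((m * 4).+1 + (1 + (1 + (1 + 3)))))) _
  (fun _ Qs => Qs)); first by lia.
apply/wp_seq/wp_write/wp_seq/wp_write/wp_seq.
set s2 := update _ _ _ _.
apply: (wp_conseq (leqnn _) _ (wp_find_best (s := s2) _ _ _ _)) => //.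
move=> s3' [frame best_lt best].
have {}frame a i : a != 5 -> a != 8 -> s3' a i = s1 a i.
  by move=> ne5 ne8; rewrite frame // /s2 /update (negPf ne5) (negPf ne8).
set b := s3' 8 0 in best_lt best.
have {}best t : t < m -> worth (s1 6 0).-1 t + s1 3 b <=
                         worth (s1 6 0).-1 b + s1 3 t by exact: best.
have done_I (F : state) : F 0 =1 s1 0 -> F 2 =1 s1 2 ->
    F 3 =1 (fun t => if t == b then s1 3 t + 1 else s1 3 t) ->
    F 4 =1 (fun t => if t == b then s1 6 0 else s1 4 t) ->
    F 6 0 = (if s1 4 b == 0 then (s1 7 0).+2 else s1 4 b) ->
    F 7 0 = s1 7 0 + (s1 4 b == 0) -> I F /\ mu F < mu s1.
  move=> F0 F2 F3 F4 F6 F7; split; last first.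
    exact: (auction_progress worth_le inv cnt_lt best_lt best F3 F4).
  split=> [i | y |]; rewrite ?F0 ?F2 // F6 F7.
  exact: (auction_step worth_le inv cnt_lt best_lt best F3 F4).
apply/wp_seq/wp_write/wp_seq/wp_write/wp_seq/wp_write.
apply: (@wp_if _ _ _ 2) => /=; rewrite /update /= -/b frame //.
  move=> ob; apply: (wp_conseq (t := 1) _ (fun _ Qs => Qs)) => //.
  apply/wp_write/done_I; rewrite /update /= -/b.
  - by move=> t; exact: frame.
  - by move=> t; exact: frame.
  - by move=> t; rewrite !frame //; case: eqP => // ->.
  - by move=> t; rewrite !frame.
  - by rewrite (negPf ob).
  - by rewrite frame // (negPf ob) addn0.
move=> ob; apply/(@wp_seq _ _ 1 1)/wp_write/wp_write/done_I; rewrite /update /= -/b.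
- by move=> t; exact: frame.
- by move=> t; exact: frame.
- by move=> t; rewrite !frame //; case: eqP => // ->.
- by move=> t; rewrite !frame.
(* The counter is increased before the next bidder is computed from it, hence two successors. *)
- by rewrite frame // ob eqxx !addn1.
- by rewrite frame // ob eqxx.
Qed.

End BiddingLoop.

(** Goods are stored with a shift by one; as the stored numbers are positive and distinct, so are
    the addresses [(s 4 t).-1], and no output cell is overwritten. *)
Lemma wp_write_output s : s 0 =1 inp ->
  (forall t, t < m -> 0 < s 4 t) ->
  (forall t t', t < m -> t' < m -> s 4 t = s 4 t' -> t = t') ->
  wp write_output (1 + (m * 3).+1)
    (fun s' => forall t, t < m -> s' 1 (s 4 t).-1 = t %% n) s.
Proof.
move=> s_inp o_gt0 o_inj; apply/wp_seq/wp_write; set s0 := update _ _ _ _.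
pose I (s' : state) := [/\ forall a i : nat, a != 1 -> a != 5 -> s' a i = s a i,
  s' 5 0 <= m & forall t, t < s' 5 0 -> s' 1 (s 4 t).-1 = t %% n].
pose mu (s' : state) := m - s' 5 0.
have I0 : I s0 by split=> // a i _ ne5; rewrite /s0 /update (negPf ne5).
have mu0 : mu s0 <= m by exact: leq_subr.
have I_inp s1 : I s1 -> s1 0 =1 inp by case=> frame _ _ i; rewrite frame.
apply: (wp_conseq (leqnn _) _ (wp_while (I := I) (t := 2) _ I0 mu0)).
  move=> s1 [Is1 /= /eqP]; rewrite !I_inp // inp1 subn_eq0 => le_x t t_lt.
  by have [_ _] := Is1; apply; apply: leq_trans t_lt le_x.
move=> s1 Is1; rewrite [eval _ _]/= !I_inp // inp1 subn_eq0_ltn => x_lt.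
have [frame x_le out] := Is1.
apply/(@wp_seq _ _ 1 1)/wp_write/wp_write.
rewrite /= !I_inp // inp0 sub_divn /mu /update /=; split; last by lia.
split=> //= [a i ne1 ne5 | | t]; [ | lia |].
  by rewrite (negPf ne1) (negPf ne5); exact: frame.
rewrite addn1 ltnS leq_eqVlt (frame 4) // subn1.
case: eqP => [-> _ | ne_tx /= t_lt]; first by rewrite eqxx.
case: eqP => [e | _]; last exact: out.
have t_lt_m := ltn_trans t_lt x_lt.
case: ne_tx; apply: o_inj => //.
by have := o_gt0 _ t_lt_m; have := o_gt0 _ x_lt; lia.
Qed.

Definition run_time := (n * m * m * 4).+1 +
  (1 + ((m * (3 * m * m).+2 * (4 * m + 10)).+1 + (1 + (m * 3).+1))).

Lemma wp_allocate s : s 0 =1 inp -> (forall a i, a != 0 -> s a i = 0) ->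
  wp allocate run_time
    (fun s' => exists p o cur,
       auction_inv m (3 * m * m).+1 (worth (valued (n * m * m))) p o cur m /\
       forall t, t < m -> s' 1 (o t).-1 = t %% n) s.
Proof.
move=> s_inp s_0; apply: wp_seq.
apply: wp_conseq (leqnn _) _ (wp_mark_valued s_inp s_0) => s1 [frame tab].
apply/wp_seq/wp_write/wp_seq; set s2 := update _ _ _ _.
have s2E a i : a != 2 -> a != 5 -> a != 6 -> s2 a i = s a i.
  by move=> ne2 ne5 ne6; rewrite /s2 /update (negPf ne6) frame.
apply: (wp_conseq (leqnn _) _
  (wp_auction (tab := valued (n * m * m)) (s := s2) _ _ _ _ _ _)) => //.
- move=> s3 [s3_inp [cur inv]].
  apply: (wp_conseq (leqnn _) _ (wp_write_output s3_inp _ _)).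
  + by move=> s4 out; exists (s3 3), (s3 4), cur.
  + by move=> t t_lt; case/andP: (auction_final inv t_lt).
  + move=> t t' t_lt t'_lt; apply: (owner_inj inv) => //.
    by rewrite -lt0n; case/andP: (auction_final inv t_lt).
- by move=> i; rewrite s2E.
- by move=> i; rewrite s2E // s_0.
- by move=> i; rewrite s2E // s_0.
- by rewrite s2E // s_0.
Qed.

End Correctness.

(** * Instances and encodings *)

Local Open Scope ring_scope.

(** A test by comparisons only, without knowledge of the agent's two values. In a constant row it
    selects no good, whichever value the row has. *)
Definition above_min (R : realFieldType) n m (v : 'M[R]_(n, m)) i j : bool :=
  [exists j', v i j' < v i j].

(** If the low value occurs in the row, it is the base and the gap is [a - b]. Otherwise the row is
    constantly [a], which becomes the base, with an arbitrary positive gap. *)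
Lemma bivalued_decomposition (R : realFieldType) n m (v : 'M[R]_(n, m)) :
  personalized_bivalued v -> exists b d : 'I_n -> R,
    [/\ forall i j, v i j = b i + d i * (above_min v i j)%:R,
        forall i, 0 <= b i & forall i, 0 < d i].
Proof.
move=> biv.
suff /fin_all_exists[b /fin_all_exists[d bd]] : forall i, exists b d : R,
    [/\ forall j, v i j = b + d * (above_min v i j)%:R, 0 <= b & 0 < d].
  by exists b, d; split=> i; [move=> j|..]; case: (bd i).
move=> i; have [a [b [lt_ba b_ge0 vab]]] := biv i.
have a_ge0 : 0 <= a by apply: ltW; apply: le_lt_trans lt_ba.
have [/existsP[j0 /eqP vj0] | /existsPn no_b] := boolP [exists j, v i j == b].
  exists b, (a - b); split=> [j | // |]; last by rewrite subr_gt0.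
  have [vj | vj] := vab j.
    suff -> : above_min v i j by rewrite mulr1 vj addrC subrK.
    by apply/existsP; exists j0; rewrite vj vj0.
  suff -> : above_min v i j = false by rewrite mulr0 addr0.
  apply/existsPn => j'; rewrite vj -leNgt.
  by case: (vab j') => ->; rewrite // ltW.
have va j : v i j = a by case: (vab j) (no_b j) => // ->; rewrite eqxx.
exists a, 1; split=> // j.
suff -> : above_min v i j = false by rewrite mulr0 addr0 va.
by apply/existsPn => j'; rewrite !va ltxx.
Qed.

(** A row with a good above its minimum also has one at the minimum, so the [0/1] row separates the
    same goods; constant rows become zero. *)
Lemma above_min_idem (R R' : realFieldType) n m (v : 'M[R]_(n, m)) :
  personalized_bivalued v ->
  above_min (\matrix_(i, j) (above_min v i j)%:R : 'M[R']_(n, m)) =2 above_min v.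
Proof.
move=> /bivalued_decomposition[b [d [vE b_ge0 d_gt0]]] i j.
apply/existsP/idP => [[j'] | vj].
  by rewrite !mxE ltr_nat; case: (above_min v i j) => //; rewrite ltn0.
have /existsP[j' lt_j'] := vj; exists j'; rewrite !mxE vj.
move: lt_j'; rewrite !vE vj; case: (above_min v i j') => /=; rewrite ?ltxx ?ltr01 //.
Qed.

Lemma above_min_ratr (R : realFieldType) n m (v : 'M[rat]_(n, m)) :
  above_min (map_mx (ratr : rat -> R) v) =2 above_min v.
Proof. by move=> i j; apply: eq_existsb => j'; rewrite !mxE ltr_rat. Qed.

Local Close Scope ring_scope.

(** * Decoding the input and extracting an equilibrium *)

Lemma nth_flatten_uniform (T : Type) (x0 : T) c (ss : seq (seq T)) i j :
  all (fun s => size s == c) ss -> i < size ss -> j < c ->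
  nth x0 (flatten ss) (i * c + j) = nth x0 (nth [::] ss i) j.
Proof.
elim: ss i => // s ss IH [|i] /= /andP[/eqP sc ssc] i_lt j_lt; rewrite nth_cat sc.
  by rewrite mul0n add0n j_lt.
by rewrite mulSn -addnA ltnNge leq_addr /= addKn IH.
Qed.

Lemma size_flatten_uniform (T : Type) c (ss : seq (seq T)) :
  all (fun s => size s == c) ss -> size (flatten ss) = size ss * c.
Proof.
by elim: ss => //= s ss IH /andP[/eqP sc /IH ssE]; rewrite size_cat sc ssE mulSn.
Qed.

Lemma nth_encode n m (v : 'M[rat]_(n, m)) (i : 'I_n) (j : 'I_m) :
  nth 0 (encode v) (2 * (i * m + j) + 2) = `|numq (v i j)|%N /\
  nth 0 (encode v) (2 * (i * m + j) + 3) = `|denq (v i j)|%N.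
Proof.
pose pair i j := [:: `|numq (v i j)|%N; `|denq (v i j)|%N].
pose rows := [seq [seq pair i j | j <- enum 'I_m] | i <- enum 'I_n].
have rows_uniform : all (fun s => size s == m) rows.
  by apply/allP => s /mapP[i' _ ->]; rewrite size_map size_enum_ord.
have pairs_uniform : all (fun s => size s == 2) (flatten rows).
  by apply/allP => s /flattenP[r /mapP[i' _ ->] /mapP[j' _ ->]].
have pairE : nth [::] (flatten rows) (i * m + j) = pair i j.
  rewrite (nth_flatten_uniform _ rows_uniform) ?size_map -?enumT ?size_enum_ord //.
  rewrite (nth_map i) -?enumT ?size_enum_ord // nth_ord_enum.
  by rewrite (nth_map j) -?enumT ?size_enum_ord // nth_ord_enum.
have lt_ij : i * m + j < size (flatten rows).
  rewrite (size_allpairs pair) !size_enum_ord.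
  by have := ltn_ord i; have := ltn_ord j; nia.
have enc c : c < 2 ->
    nth 0 (encode v) (2 * (i * m + j) + c.+2) = nth 0 (pair i j) c.
  move=> c_lt; rewrite !addnS /= mulnC -pairE.
  exact: (nth_flatten_uniform 0 pairs_uniform).
by split; [exact: (enc 0) | exact: (enc 1)].
Qed.

Lemma ltr_rat_nat (x y : rat) : (0 <= x)%R -> (0 <= y)%R ->
  (x < y)%R = (`|numq x|%N * `|denq y|%N < `|numq y|%N * `|denq x|%N).
Proof.
move=> x_ge0 y_ge0; rewrite -ltz_nat !PoszM !absz_denq.
rewrite !gez0_abs ?numq_ge0 //; exact: lt_ratE.
Qed.

Lemma valued_above_min n m (v : 'M[rat]_(n, m)) (i : 'I_n) (j : 'I_m) :
  (forall i j, 0 <= v i j)%R ->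
  valued m (nth 0 (encode v)) (n * m * m) (i * m + j) = above_min v i j.
Proof.
move=> v_ge0.
have m_gt0 : 0 < m by exact: leq_ltn_trans (ltn_ord j).
have divE a (j' : 'I_m) : (a * m + j') %/ m = a.
  by rewrite divnMDl // divn_small ?addn0.
have exceedsE (j' : 'I_m) :
    exceeds m (nth 0 (encode v)) ((i * m + j) * m + j') = (v i j' < v i j)%R.
  rewrite /exceeds !divE modnMDl modn_small // !(nth_encode v i _).1.
  by rewrite !(nth_encode v i _).2 -ltr_rat_nat.
apply/hasP/existsP => [[z _ /andP[/eqP zE]] | [j' lt_j']].
  rewrite (divn_eq z m) zE => lt_z.
  by exists (Ordinal (ltn_pmod z m_gt0)); rewrite -exceedsE.
exists ((i * m + j) * m + j'); last by rewrite exceedsE lt_j' andbT divE.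
rewrite mem_iota add0n /=; have := ltn_ord i; have := ltn_ord j.
have := ltn_ord j'; nia.
Qed.

(** As [m = k * n], sending [(i, r)] to [r * n + i] numbers the slots by the naturals below [m].
    Along it [almost_best] becomes the equilibrium condition, and injectivity between [m] slots and
    [m] goods gives every good an owner. *)
Lemma equilibrium_of_auction n m k (h : 'I_n -> 'I_m -> bool)
    (tab : nat -> bool) p o cur (f : nat -> nat) :
  m = k * n -> (forall (i : 'I_n) (j : 'I_m), tab (i * m + j) = h i j) ->
  auction_inv m (3 * m * m).+1 (worth n m tab) p o cur m ->
  (forall t, t < m -> f (o t).-1 = t %% n) ->
  exists g : 'I_n * 'I_k -> 'I_m, exists P : 'I_n * 'I_k -> nat,
    [/\ injective g, equilibrium h g P & represents f (bundle g)].
Proof.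
move=> mE tabE inv fE.
pose slot (s : 'I_n * 'I_k) := s.2 * n + s.1.
have slot_lt s : slot s < m.
  by rewrite mE /slot; have := ltn_ord s.1; have := ltn_ord s.2; nia.
have slot_mod s : slot s %% n = s.1.
  by rewrite /slot modnMDl modn_small.
have slot_div s : slot s %/ n = s.2.
  by rewrite /slot divnMDl ?(leq_ltn_trans _ (ltn_ord s.1)) // divn_small ?addn0.
have o_ok s : 0 < o (slot s) <= m by exact: (auction_final inv).
have good_lt s : (o (slot s)).-1 < m by case: (o _) (o_ok s).
pose g s := Ordinal (good_lt s).
have g_inj : injective g.
  move=> s t /(congr1 val) /= e.
  have {}e : slot s = slot t.
    by apply: (owner_inj inv) => //; have := o_ok s; have := o_ok t; lia.
  case: s t e => [i r] [i' r'] e; congr pair; apply: val_inj.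
    by rewrite -[LHS](slot_mod (i, r)) e slot_mod.
  by rewrite -[LHS](slot_div (i, r)) e slot_div.
exists g, (p \o slot); split=> // [s t | i j].
  have os : o (slot s) != 0 by have := o_ok s; lia.
  have := almost_best inv (slot_lt s) (slot_lt t) os.
  by rewrite /worth !slot_mod !slot_div !(tabE _ (g s)).
have [u _ uK] := slot_bij mE g_inj.
by rewrite -(uK j) mem_bundle // fE // slot_mod.
Qed.

(** * Polynomial time bound *)

(** The factor [100] comes from the step count [100 * l ^ 4], and [102] from the bound [102 * l ^ 4]
    on the length of the numbers involved. *)
Definition time_constant := 100 * 102 * program_weight allocate.

Lemma run_time_leq n m l : 0 < n -> 0 < m -> n <= l -> m <= l ->
  run_time n m <= 100 * l ^ 4.
Proof.
move=> n_gt0 m_gt0 n_le m_le; have l_gt0 : 0 < l by exact: leq_trans n_le.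
have nm_le : n * m * m <= l * l * l by rewrite !leq_mul.
have m3_le : m * (3 * m * m).+2 <= 5 * (l * l * l).
  have : m * (3 * m * m).+2 <= l * (3 * l * l).+2 by rewrite !leq_mul // !ltnS !leq_mul.
  nia.
have m4_le : m * (3 * m * m).+2 * (4 * m + 10) <= 5 * (l * l * l) * (14 * l).
  by rewrite leq_mul //; lia.
have l3_le : l * l * l <= l * l * l * l by rewrite leq_pmulr.
have l1_le : l <= l * l * l * l by rewrite -2!mulnA leq_pmulr // !muln_gt0 l_gt0.
rewrite /run_time !expnS expn0 muln1 !mulnA; lia.
Qed.

Lemma encoding_length_ge n m (v : 'M[rat]_(n, m)) : 0 < n -> 0 < m ->
  n <= encoding_length (encode v) /\ m <= encoding_length (encode v).
Proof.
move=> n_gt0 m_gt0.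
have size_le (w : seq nat) : size w <= encoding_length w.
  by rewrite -sum1_size; apply: leq_sum.
have := size_le (encode v); rewrite /= (@size_flatten_uniform _ 2).
  by rewrite size_allpairs !size_enum_ord; nia.
by apply/allP => s /allpairsP[ij [_ _ ->]].
Qed.

Lemma nth_leq_encoding_length w i : nth 0 w i <= 2 ^ encoding_length w.
Proof.
case: (ltnP i (size w)) => [i_lt | ?]; last by rewrite nth_default.
apply: leq_trans (ltnW (ltn_bitlen _)) _; rewrite leq_exp2l //.
rewrite /encoding_length (big_nth 0) big_mkord (bigD1 (Ordinal i_lt)) //=.
exact: leq_addr.
Qed.

Lemma allocate_correct n m k (v : 'M[rat]_(n, m)) :
  0 < n -> 0 < m -> m = k * n -> (forall i j, 0 <= v i j)%R ->
  let l := encoding_length (encode v) in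
  exists t s (g : 'I_n * 'I_k -> 'I_m) (p : 'I_n * 'I_k -> nat),
  [/\ exec allocate (initial_state (encode v)) t s,
      t <= time_constant * l ^ 8,
      represents (output s) (bundle g),
      injective g & equilibrium (above_min v) g p].
Proof.
move=> n_gt0 m_gt0 mE v_ge0 l.
have [n_le m_le] := encoding_length_ge v n_gt0 m_gt0.
have [||t0 [s [r t0_le [p [o [cur [inv out]]]]]]] := @wp_allocate n m
  (nth 0 (encode v)) n_gt0 m_gt0 erefl erefl (initial_state (encode v)).
  by [].
  by move=> a i /negPf ne; rewrite /initial_state ne.
have tabE (i : 'I_n) (j : 'I_m) := valued_above_min i j v_ge0.
have [g [P [g_inj eqP rep]]] := equilibrium_of_auction mE tabE inv out.
have init_le a i : initial_state (encode v) a i <= 2 ^ l.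
  by rewrite /initial_state; case: (a == 0) => //; exact: nth_leq_encoding_length.
have [_ [t ex t_le]] := run_exec r tame_allocate init_le (leqnn _).
exists t, s, g, P; split=> //; apply: leq_trans t_le _.
have {}t0_le : t0 <= 100 * l ^ 4 by apply: leq_trans t0_le _; exact: run_time_leq.
have l_gt0 : 0 < l by exact: leq_trans n_le.
have l_le : l <= l ^ 4 by rewrite -{1}(expn1 l) leq_pexp2l.
(* Cells start at most at [2 ^ l] and grow by at most [t0], so [l + t0 + 1] bits suffice. *)
have len_le : bitlen (2 ^ l + t0) <= 102 * l ^ 4.
  apply: (@leq_trans (l + t0 + 1)); last by lia.
  rewrite bitlen_leq ?addn1 // expnS expnD.
  have := ltn_expl t0 (isT : 1 < 2); have : 0 < 2 ^ l by rewrite expn_gt0.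
  nia.
apply: leq_trans (leq_mul t0_le (leq_mul (leqnn _) len_le)) _.
rewrite /time_constant (expnD l 4 4); set x := l ^ 4.
by move: (program_weight _) => c; lia.
Qed.

(** * Fairness of the computed allocation *)

Local Open Scope ring_scope.

Lemma equilibrium_fair (R : realFieldType) n m k (v : 'M[R]_(n, m))
    (g : 'I_n * 'I_k -> 'I_m) p :
  personalized_bivalued v -> (0 < k)%N -> m = (k * n)%N -> injective g ->
  equilibrium (above_min v) g p ->
  [/\ balanced_allocation k (bundle g), EF1 v (bundle g) & fPO k v (bundle g)].
Proof.
move=> /bivalued_decomposition[b [d [vE b_ge0 d_gt0]]] k_gt0 mE g_inj eq_p.
split; first exact: bundle_balanced.
- exact: equilibrium_EF1 vE b_ge0 d_gt0 k_gt0 mE g_inj eq_p.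
- exact: equilibrium_fPO vE d_gt0 k_gt0 mE g_inj eq_p.
Qed.

Theorem theorem3 :
  (forall (R : realFieldType) (n m k : nat) (v : 'M[R]_(n, m)),
     (0 < n)%N -> (0 < m)%N -> (0 < k)%N -> m = (k * n)%N ->
     personalized_bivalued v ->
     exists A : 'I_n -> {set 'I_m},
       [/\ balanced_allocation k A, EF1 v A & fPO k v A])
  /\
  (exists (p : program) (q : {poly nat}),
     forall (R : realFieldType) (n m k : nat) (v : 'M[rat]_(n, m)),
     (0 < n)%N -> (0 < m)%N -> (0 < k)%N -> m = (k * n)%N ->
     personalized_bivalued (map_mx (ratr : rat -> R) v) ->
     exists (t : nat) (s : state) (A : 'I_n -> {set 'I_m}),
       [/\ exec p (initial_state (encode v)) t s,
           (t <= q.[encoding_length (encode v)])%N,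
           represents (output s) A
         & [/\ balanced_allocation k A,
               EF1 (map_mx (ratr : rat -> R) v) A
             & fPO k (map_mx (ratr : rat -> R) v) A]]).
Proof.
split.
  move=> R n m k v n_gt0 m_gt0 k_gt0 mE biv.
  (* Existence over any ordered field follows from running the program on the rational [0/1] matrix
     of valued goods. *)
  pose v' : 'M[rat]_(n, m) := \matrix_(i, j) (above_min v i j)%:R.
  have v'_ge0 i j : 0 <= v' i j by rewrite mxE ler0n.
  have [_ [_ [g [p [_ _ _ g_inj eq_p]]]]] := allocate_correct n_gt0 m_gt0 mE v'_ge0.
  exists (bundle g); apply: (equilibrium_fair biv k_gt0 mE g_inj (p := p)) => s t.
  by have := eq_p s t; rewrite !(above_min_idem rat biv).
exists allocate, (time_constant%:P * 'X^8)%R.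
move=> R n m k v n_gt0 m_gt0 k_gt0 mE biv.
(* The encoding drops signs, so nonnegativity is recovered from the bivalued form. *)
have v_ge0 i j : 0 <= v i j.
  have [b [d [vE b_ge0 d_gt0]]] := bivalued_decomposition biv.
  rewrite -(ler0q R) -[ratr _](mxE map_mx_key (fun i j => ratr (v i j))) vE.
  by rewrite addr_ge0 // mulr_ge0 // ltW.
have [t [s [g [p [ex t_le rep g_inj eq_p]]]]] :=
  allocate_correct n_gt0 m_gt0 mE v_ge0.
exists t, s, (bundle g); split=> //.
  rewrite hornerM hornerC hornerXn; exact: t_le.
apply: (equilibrium_fair biv k_gt0 mE g_inj (p := p)) => x y.
by rewrite !above_min_ratr; exact: eq_p.
Qed.
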